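(* Let $n\ge 1$ and $\alpha\in(0,1)$. Let the $n$ pairs of hypotheses $(H_{j1},H_{j2})$, $j=1,\dots,n$, be partitioned into $b$ blocks, so that $\mathcal{F}_1=\{H_{ji}: j=1,\dots,n,\ i=1,2\}$ is the disjoint union of subfamilies $\mathcal{F}_{11},\dots,\mathcal{F}_{1b}$, where $\mathcal{F}_{1k}$ consists of $n_k\ge 1$ full pairs and $\sum_{k=1}^b n_k=n$. Suppose assumptions A.1, A.2 and A.3$'$ (between-block dependence), stated in the context, hold. Consider the procedure (Procedure 4) which, for each $k=1,\dots,b$, applies to the $2n_k$ $p$-values of $\mathcal{F}_{1k}$ the stepdown procedure with critical values $\frac{n_k\alpha/n}{n_k-j+1+n_k\alpha/n}$, $j=1,\dots,n_k$, obtaining a set $K_k$ of rejected hypotheses, and then rejects all hypotheses in $\bigcup_{k=1}^b K_k$. Then this procedure strongly controls $\mathrm{FWER}_{\mathcal{F}_1}$ at level $\alpha$; that is, $\mathrm{FWER}_{\mathcal{F}_1}(\theta)\le\alpha$ for every parameter vector $\theta$.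
   Context: Setting. $T_1,\dots,T_n$ are real-valued test statistics whose joint law $\mathrm{Pr}_\theta$ depends on an unknown vector $\theta=(\theta_1,\dots,\theta_n)$ of real parameters. $T_j$ has cumulative distribution function $F_{j,\theta_j}$ depending only on $\theta_j$; $F_{j,0}$ is continuous and symmetric about zero, $F_{j,0}(-t)=1-F_{j,0}(t)$ for all $t$; and $F_{j,\theta_j}(t)$ is non-increasing in $\theta_j$ for each fixed $t$. Hypotheses and $p$-values. For $j=1,\dots,n$: $H_{j1}:\theta_j\le 0$ (versus $\theta_j>0$), with $p$-value $1-F_{j,0}(T_j)$, and $H_{j2}:\theta_j>0$ (versus $\theta_j<0$), with $p$-value $F_{j,0}(T_j)$. Under any $\theta$ exactly one of $H_{j1},H_{j2}$ is true. Let $H_j$ denote the true one and $H_{n+j}$ the false one, with $p$-values $P_j$ and $P_{n+j}=1-P_j$; thus $P_j=1-F_{j,0}(T_j)$ if $\theta_j\le 0$ and $P_j=F_{j,0}(T_j)$ if $\theta_j>0$. Put $I_0=\{1,\dots,n\}$ (indices of the true nulls). The procedure uses only the $p$-values and not the knowledge of which hypotheses are true. Stepdown procedure. For a family of $2m$ hypotheses with ordered $p$-values $P_{(1)}\le\dots\le P_{(2m)}$ and associated hypotheses $H_{(1)},\dots,H_{(2m)}$, the stepdown procedure with critical values $\alpha_1\le\dots\le\alpha_m$ rejects $H_{(1)},\dots,H_{(i^* )}$ and accepts the rest, where $i^*=\max\{1\le i\le m: P_{(j)}\le\alpha_j \text{ for all } j\le i\}$ if the maximum exists; otherwise it accepts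 all hypotheses. Error rate. $V_1$ is the number of true hypotheses of $\mathcal{F}_1$ that are rejected, and $\mathrm{FWER}_{\mathcal{F}_1}(\theta)=\mathrm{Pr}_\theta\{V_1\ge 1\}$. Assumptions. A.1: for each $j\in I_0$ and each $\theta_j$, $\mathrm{Pr}_{\theta_j}\{P_j\le p\}\le p$ for all $0\le p\le 1$, with equality when $\theta_j=0$ (i.e. $P_j\sim U(0,1)$ when $\theta_j=0$). A.2: for each $j\in I_0$ and each $\theta_j$, $\mathrm{Pr}_{\theta_j}\{P_j\le p\mid P_j\le p'\}\le \mathrm{Pr}_{\theta_j=0}\{P_j\le p\mid P_j\le p'\}$ for all $0\le p\le p'\le 1$ (whenever the conditioning events have positive probability). On the right-hand side $P_j$ is the same function of $T_j$ as on the left and $T_j\sim F_{j,0}$, so the right-hand side equals $p/p'$. A.3$'$ (between-block dependence): for each $k=1,\dots,b$, the test statistics corresponding to the true null hypotheses within the subfamily $\mathcal{F}_{1k}$ (i.e. the $T_j$ for the $n_k$ pairs in block $k$) are mutually independent; no assumption is made on the dependence between different blocks. *)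

(* Defs.v *)
From HB Require Import structures.
From mathcomp Require Export all_boot all_order all_algebra.
From mathcomp Require Export all_classical all_reals all_analysis.
Import Order.TTheory GRing.Theory Num.Theory.
Import numFieldNormedType.Exports.

Set Implicit Arguments.
Unset Strict Implicit.
Unset Printing Implicit Defensive.

Local Open Scope classical_set_scope.
Local Open Scope ring_scope.

(** * Stepdown procedures *)

(* Ranks are 1-based, as are the critical values [a 1, a 2, ...].  Equal
   p-values are listed in the order of [enum F].  For [block_rejections] below
   with [0 < alpha < 1] tie-breaking does not affect the rejected set: the
   critical values are nondecreasing and smaller than 1/2, and the p-values come
   in pairs [q, 1 - q], so at most half of them are smaller than 1/2. *)
Section stepdown.
Context {R : realType} {H : finType}.
Variables (F : {set H}) (p : H -> R).

Definition ordered_hyps : seq H := sort (fun h h' => p h <= p h') (enum F).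

Definition ordered_pvalue (i : nat) : R := nth 0 (map p ordered_hyps) i.-1.

(* The value 0 encodes that the maximum does not exist. *)
Definition stepdown_index (m : nat) (a : nat -> R) : nat :=
  \max_(1 <= i < m.+1 |
        all (fun j => ordered_pvalue j <= a j) (iota 1 i)) i.

Definition stepdown (m : nat) (a : nat -> R) : {set H} :=
  [set h in take (stepdown_index m a) ordered_hyps].

End stepdown.

(** * Probability *)

(* Only meaningful when [B] has positive probability. *)
Definition cond_prob d (Omega : measurableType d) (R : realType)
    (P : probability Omega R) (A B : set Omega) : R :=
  fine (P (A `&` B)) / fine (P B).

Definition mutually_independent d (Omega : measurableType d) (R : realType)
    (P : probability Omega R) (I : finType) (J : {set I})
    (X : I -> {RV P >-> R}) : Prop :=
  forall (S : {set I}) (B : I -> set R),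
    S \subset J -> (forall j, measurable (B j)) ->
    P (\bigcap_(j in [set` S]) (X j @^-1` B j))
      = (\prod_(j in S) P (X j @^-1` B j))%E.
Arguments mutually_independent {d Omega R} P {I} J X.

(** * The directional testing problem *)

(* The hypothesis [(j, false)] is [theta j <= 0] (alternative [theta j > 0])
   and the hypothesis [(j, true)] is [0 < theta j]. *)
Definition hyp (n : nat) : finType := ('I_n * bool)%type.

Section directional.
Context d (Omega : measurableType d) (R : realType) (n : nat).
(* [F0 j] is the distribution function of [T j] when [theta j = 0]. *)
Variables (T : 'I_n -> {mfun Omega >-> R}) (F0 : 'I_n -> R -> R).

Definition hyp_holds (theta : 'I_n -> R) (h : hyp n) : bool :=
  if h.2 then 0 < theta h.1 else theta h.1 <= 0.

Definition pvalue (w : Omega) (h : hyp n) : R :=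
  if h.2 then F0 h.1 (T h.1 w) else 1 - F0 h.1 (T h.1 w).

Definition true_hyp (theta : 'I_n -> R) (j : 'I_n) : hyp n := (j, 0 < theta j).

Definition true_pvalue (theta : 'I_n -> R) (j : 'I_n) (w : Omega) : R :=
  pvalue w (true_hyp theta j).

Definition num_false_rejections (theta : 'I_n -> R)
    (rejected : Omega -> {set hyp n}) (w : Omega) : nat :=
  #|[set h in rejected w | hyp_holds theta h]|.

Definition FWER (Pr : ('I_n -> R) -> probability Omega R)
    (rejected : Omega -> {set hyp n}) (theta : 'I_n -> R) : \bar R :=
  Pr theta [set w | (1 <= num_false_rejections theta rejected w)%N].

(** Blocks of pairs are represented by the sets of indices of their pairs. *)

Definition block_family (J : {set 'I_n}) : {set hyp n} :=
  [set h : hyp n | h.1 \in J].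

Definition block_crit (alpha : R) (J : {set 'I_n}) (j : nat) : R :=
  let c := #|J|%:R * alpha / n%:R in
  c / (#|J|%:R - j%:R + 1 + c).

Definition block_rejections (alpha : R) (J : {set 'I_n}) (w : Omega) :
    {set hyp n} :=
  stepdown (block_family J) (pvalue w) #|J| (block_crit alpha J).

Definition blockwise_procedure (alpha : R) (blocks : {set {set 'I_n}})
    (w : Omega) : {set hyp n} :=
  (\bigcup_(J in blocks) block_rejections alpha J w)%SET.

End directional.

(* Main.v *)
Require Import Defs.
From mathcomp Require Import all_boot all_order all_algebra.
From mathcomp Require Import all_classical all_reals all_analysis.
From mathcomp Require Import measurable_realfun lra.
Import Order.TTheory GRing.Theory Num.Theory.
Import numFieldNormedType.Exports.
Set Implicit Arguments.
Unset Strict Implicit.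
Unset Printing Implicit Defensive.
Local Open Scope classical_set_scope.
Local Open Scope ring_scope.

(** For a block [J] of [m] pairs let [x j] be the true p-value of pair [j], so
    that [1 - x j] is the false one, put [c = m * alpha / n] and let [a] be the
    critical values, for which [a r.+1 / (1 - a r.+1) = c / (m - r)].  Let
    [L j] be the number of false hypotheses rejected by the stepdown procedure
    run on the false p-values of the pairs other than [j] alone.  If a true
    hypothesis is rejected, the first such, of pair [j] say, satisfies
    [x j <= a (L j).+1].  As [L j] is independent of [x j] and
    [P (x j <= a) / a <= P (x j < 1 - a) / (1 - a)] by A.2, the probability of
    [x j <= a (L j).+1] is at most [c] times the expectation of
    [1 / (m - L j)] on the event [1 - x j > a (L j).+1].  On that event pair [j]
    does not influence the procedure run on all false p-values, so [L j] is its
    number of rejections and [j] is one of the [m - L j] accepted pairs: these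
    terms sum to at most 1 over [j].  Hence block [J] has error probability at
    most [c], and the [c] sum to [alpha] over the blocks. *)

(** * Measurability and finite sums of probabilities *)

Lemma measurable_sublevel (d : measure_display) (T : measurableType d)
    (R : realType) (f : T -> R) (p : R) :
  measurable_fun setT f -> measurable [set x | f x <= p].
Proof.
move=> mf; rewrite (_ : [set x | f x <= p] = f @^-1` `]-oo, p]); last first.
  by apply/seteqP; split => x /=; rewrite in_itv.
by rewrite -[X in measurable X]setTI; exact: mf.
Qed.

Lemma measurable_strict_sublevel (d : measure_display) (T : measurableType d)
    (R : realType) (f : T -> R) (p : R) :
  measurable_fun setT f -> measurable [set x | f x < p].
Proof.
move=> mf; rewrite (_ : [set x | f x < p] = f @^-1` `]-oo, p[); last first.
  by apply/seteqP; split => x /=; rewrite in_itv.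
by rewrite -[X in measurable X]setTI; exact: mf.
Qed.

Lemma le_fine_prob (d : measure_display) (T : measurableType d) (R : realType)
    (P : probability T R) (A B : set T) :
  measurable A -> measurable B -> A `<=` B -> fine (P A) <= fine (P B).
Proof.
move=> mA mB AB; apply: fine_le; rewrite ?fin_num_measure//.
by apply: le_measure; rewrite ?inE.
Qed.

Lemma integral_sum_indic (d : measure_display) (Omega : measurableType d)
    (R : realType) (P : probability Omega R) (K : finType)
    (w : K -> R) (A : K -> set Omega) :
  (forall k, 0 <= w k) -> (forall k, measurable (A k)) ->
  (\int[P]_x (\sum_k w k * \1_(A k) x)%:E
   = (\sum_k w k * fine (P (A k)))%:E)%E.
Proof.
move=> w0 mA.
under eq_integral do rewrite -sumEFin.
rewrite ge0_integral_sum //; last first.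
- by move=> k x _; rewrite lee_fin mulr_ge0.
- move=> k; apply/measurable_EFinP; apply: measurable_funM => //.
rewrite -sumEFin; apply: eq_bigr => k _.
rewrite EFinM fineK ?fin_num_measure//.
under eq_integral do rewrite EFinM.
rewrite ge0_integralZl//.
- by rewrite integral_indic// setIT.
- by apply/measurable_EFinP; exact: measurable_indic.
- by rewrite lee_fin.
Qed.

(** Integrate the pointwise inequality. Counting arguments at a fixed outcome thus become bounds on
    probabilities; a single event enters as a sum over [unit] with weight 1. *)
Lemma ler_sum_fine_prob (d : measure_display) (Omega : measurableType d)
    (R : realType) (P : probability Omega R) (K L : finType)
    (w : K -> R) (A : K -> set Omega) (v : L -> R) (B : L -> set Omega) :
  (forall k, 0 <= w k) -> (forall l, 0 <= v l) ->
  (forall k, measurable (A k)) -> (forall l, measurable (B l)) ->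
  (forall x, \sum_k w k * \1_(A k) x <= \sum_l v l * \1_(B l) x) ->
  \sum_k w k * fine (P (A k)) <= \sum_l v l * fine (P (B l)).
Proof.
move=> w0 v0 mA mB le_AB.
rewrite -lee_fin -!integral_sum_indic//.
have msum (M : finType) (u : M -> R) (C : M -> set Omega) :
    (forall m, measurable (C m)) ->
    measurable_fun setT (fun x => (\sum_m u m * \1_(C m) x)%:E).
  move=> mC; apply/measurable_EFinP.
  by apply: measurable_sum => m; apply: measurable_funM.
apply: ge0_le_integral => //; try exact: msum.
- by move=> x _; rewrite lee_fin sumr_ge0// => k _; rewrite mulr_ge0.
- by move=> x _; rewrite lee_fin.
Qed.

(** At each outcome [x] only the index [k = V x] can contribute, so the indicators of the pieces add
    up to that of [E]. *)
Lemma fine_prob_partition (d : measure_display) (Omega : measurableType d)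
    (R : realType) (P : probability Omega R) (K : finType) (V : Omega -> K)
    (E : set Omega) :
  measurable E -> (forall k, measurable (V @^-1` [set k])) ->
  fine (P E) = \sum_k fine (P (E `&` V @^-1` [set k])).
Proof.
move=> mE mV.
have indicE x : \sum_k 1 * \1_(E `&` V @^-1` [set k]) x = \1_E x :> R.
  rewrite (bigD1 (V x)) //= big1 ?addr0 ?mul1r.
    by rewrite !indicE in_setI [X in _ && X]mem_set ?andbT.
  move=> k /eqP nVk; rewrite indicE in_setI [X in _ && X]memNset ?andbF ?mulr0//.
  by move=> /esym.
have E1 : fine (P E) = \sum_(k : unit) 1 * fine (P E).
  by rewrite sumr_const card_unit mul1r.
have E2 : \sum_k fine (P (E `&` V @^-1` [set k]))
          = \sum_k 1 * fine (P (E `&` V @^-1` [set k])).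
  by apply: eq_bigr => k _; rewrite mul1r.
have mI k : measurable (E `&` V @^-1` [set k]) by exact: measurableI.
rewrite E1 E2; apply/eqP; rewrite eq_le; apply/andP.
by split; apply: ler_sum_fine_prob => // x; rewrite indicE sumr_const card_unit mul1r.
Qed.

(** [E] is the union of the fibres of [V] over its image, a finite union. *)
Lemma measurable_fin_code (d : measure_display) (Omega : measurableType d)
    (K : finType) (V : Omega -> K) (E : set Omega) :
  (forall k, measurable (V @^-1` [set k])) ->
  (forall x y, V x = V y -> E x -> E y) -> measurable E.
Proof.
move=> mV codeE.
have -> : E = \bigcup_(k in V @` E) V @^-1` [set k].
  apply/seteqP; split => [x Ex|x [k [y Ey <-] /= Vxy]].
    by exists (V x) => //; exists x.
  exact: codeE Ey.
by apply: fin_bigcup_measurable => //; exact: finite_finset.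
Qed.

Lemma measurable_ffun_code (d : measure_display) (Omega : measurableType d)
    (I D : finType) (V : Omega -> {ffun I -> D}) :
  (forall i v, measurable [set x | V x i = v]) ->
  forall v, measurable (V @^-1` [set v]).
Proof.
move=> mV v.
have -> : V @^-1` [set v] = \bigcap_(i in [set: I]) [set x | V x i = v i].
  by apply/seteqP; split => [x /= <- //|x Vx]; apply/ffunP => i; exact: Vx.
by apply: fin_bigcap_measurable => //; exact: finite_finset.
Qed.

(** * Independence of one coordinate from events coded by the others *)

Section independence.
Context (d : measure_display) (Omega : measurableType d) (R : realType).
Context (P : probability Omega R) (I D : finType) (J : {set I}) (j : I).
Context (X : I -> {RV P >-> R}) (g : I -> R -> D) (C : set Omega).

Let code (x : Omega) : {ffun I -> option D} :=
  [ffun i => if i \in (J :\ j)%SET then Some (g i (X i x)) else None].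

Let measurable_code :
  (forall i v, measurable (g i @^-1` [set v])) ->
  forall v, measurable (code @^-1` [set v]).
Proof.
move=> mg; apply: measurable_ffun_code => i [v|].
  case: (boolP (i \in (J :\ j)%SET)) => iJ; last first.
    rewrite [X in measurable X](_ : _ = set0)//.
    by apply/seteqP; split => // x /=; rewrite ffunE (negbTE iJ).
  rewrite [X in measurable X](_ : _ = X i @^-1` (g i @^-1` [set v])).
    by apply: measurable_funPTI; exact: mg.
  by apply/seteqP; split => x /=; rewrite ffunE iJ; [case|move=> ->].
case: (boolP (i \in (J :\ j)%SET)) => iJ.
  rewrite [X in measurable X](_ : _ = set0)//.
  by apply/seteqP; split => // x /=; rewrite ffunE iJ.
rewrite [X in measurable X](_ : _ = setT)//.
by apply/seteqP; split => // x _ /=; rewrite ffunE (negbTE iJ).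
Qed.

(** Split [C] along the finitely many cells on which all codes [g i (X i x)], for [i] in [J :\ j],
    are fixed. Each cell is a rectangle in the coordinates other than [j], so independence factors
    out coordinate [j] cell by cell. *)
Lemma independent_coded_event (A : set R) :
  mutually_independent P J X -> j \in J -> measurable A ->
  (forall i v, measurable (g i @^-1` [set v])) ->
  (forall x y, (forall i, i \in (J :\ j)%SET -> g i (X i x) = g i (X i y)) ->
    C x -> C y) ->
  measurable C /\
  fine (P (X j @^-1` A `&` C)) = fine (P (X j @^-1` A)) * fine (P C).
Proof.
move=> indX jJ mA mg hC.
have mcode := measurable_code mg.
have codeC x y : code x = code y -> C x -> C y.
  move=> xy; apply: hC => i iJ.
  by move/ffunP/(_ i): xy; rewrite !ffunE iJ; case.
have mC : measurable C by exact: measurable_fin_code codeC.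
have mXA : measurable (X j @^-1` A) by exact: measurable_funPTI.
split => //.
rewrite (fine_prob_partition P (measurableI _ _ mXA mC) mcode).
rewrite [fine (P C)](fine_prob_partition P mC mcode) mulr_sumr.
apply: eq_bigr => v _.
(* A cell that meets [C] lies inside it, since [C] depends only on the code; on any other cell both
   sides vanish. *)
have [[x0 [Cx0 x0v]]|nC] := pselect (exists x, C x /\ code x = v); last first.
  have -> : C `&` code @^-1` [set v] = set0.
    by apply/seteqP; split => // x [Cx xv]; apply: nC; exists x.
  have -> : X j @^-1` A `&` C `&` code @^-1` [set v] = set0.
    by apply/seteqP; split => // x [[_ Cx] xv]; apply: nC; exists x.
  by rewrite measure0 mulr0.
have CvE : C `&` code @^-1` [set v] = code @^-1` [set v].
  apply/seteqP; split => [x []//|x xv]; split => //.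
  by apply: codeC Cx0; rewrite x0v xv.
rewrite -setIA CvE.
(* The sides of the rectangle: [A] in direction [j], the code fibre through [x0] elsewhere. The same
   [B] serves for [J] and for [J :\ j]. *)
pose B i : set R := if i == j then A else g i @^-1` [set g i (X i x0)].
have mB i : measurable (B i) by rewrite /B; case: ifP.
have cellE :
    code @^-1` [set v] = \bigcap_(i in [set` (J :\ j)%SET]) (X i @^-1` B i).
  apply/seteqP; split => [x xv i /= iJ|x xB /=].
    have : code x = code x0 by rewrite x0v.
    move=> /ffunP/(_ i); rewrite !ffunE iJ => -[gi].
    by rewrite /B; move: iJ; rewrite !inE => /andP[/negbTE -> _].
  rewrite -x0v; apply/ffunP => i; rewrite !ffunE; case: ifP => // iJ.
  have := xB i iJ; rewrite /B /=; move: iJ; rewrite !inE => /andP[/negbTE -> _].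
  by move=> /= ->.
have cellAE : X j @^-1` A `&` code @^-1` [set v]
    = \bigcap_(i in [set` J]) (X i @^-1` B i).
  rewrite cellE; apply/seteqP; split => [x [Ax xB] i /= iJ|x xB].
    have [->|ij] := eqVneq i j; first by rewrite /B eqxx.
    by apply: xB => /=; rewrite !inE ij.
  split; first by have := xB _ jJ; rewrite /B eqxx.
  by move=> i /=; rewrite !inE => /andP[_ iJ]; exact: xB.
rewrite cellAE cellE !indX//; last exact: finset.subD1set.
rewrite [in LHS](big_setD1 j)//= /B eqxx fineM//.
- by rewrite fin_num_measure.
- apply: (big_ind (fun z => z \is a fin_num)) => //.
    by move=> ? ? ? ?; rewrite fin_numM.
  by move=> i _; rewrite fin_num_measure//; apply: measurable_funPTI; exact: (mB i).
Qed.

End independence.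

(** * Combinatorics of the number of rejections *)

Lemma ex_stop_level (I : finType) (b : nat -> pred I) (S : {set I}) :
  exists r, (#|[set i in S | b r i]%SET| <= r)%N.
Proof. by exists #|S|; rewrite subset_leq_card// setIdE finset.subsetIl. Qed.

(* With [b r i] standing for "the p-value of [i] is at most the critical value
   of rank [r.+1]", this is the number of rejections of the stepdown procedure
   run on [S], expressed without sorting the p-values. *)
Definition stop_level (I : finType) (b : nat -> pred I) (S : {set I}) : nat :=
  ex_minn (ex_stop_level b S).

Section stop_level.
Context (I : finType).
Implicit Types (b : nat -> pred I) (S : {set I}).

Lemma card_stop_level b S :
  (#|[set i in S | b (stop_level b S) i]%SET| <= stop_level b S)%N.
Proof. by rewrite /stop_level; case: ex_minnP. Qed.

Lemma stop_level_min b S r :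
  (#|[set i in S | b r i]%SET| <= r)%N -> (stop_level b S <= r)%N.
Proof. by rewrite /stop_level; case: ex_minnP => ? _; exact. Qed.

Lemma stop_level_le_card b S : (stop_level b S <= #|S|)%N.
Proof.
by apply: stop_level_min; rewrite subset_leq_card// setIdE finset.subsetIl.
Qed.

Lemma stop_level_le b b' S :
  (forall r i, (r < #|S|)%N -> i \in S -> b' r i = b r i) ->
  (stop_level b' S <= stop_level b S)%N.
Proof.
(* If the level for [b] is [#|S|], the general bound suffices; otherwise it is a rank at which [b]
   and [b'] agree. *)
move=> bb'; have := stop_level_le_card b S; rewrite leq_eqVlt => /orP[/eqP ->|ltS].
  exact: stop_level_le_card.
apply: stop_level_min.
suff -> : [set i in S | b' (stop_level b S) i]%SET
        = [set i in S | b (stop_level b S) i]%SET by exact: card_stop_level.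
by apply/setP => i; rewrite !inE; apply: andb_id2l => iS; rewrite bb'.
Qed.

Lemma eq_stop_level b b' S :
  (forall r i, (r < #|S|)%N -> i \in S -> b' r i = b r i) ->
  stop_level b' S = stop_level b S.
Proof.
move=> bb'; apply/eqP; rewrite eqn_leq !stop_level_le// => r i rS iS.
by rewrite bb'.
Qed.

Context (J : {set I}) (b : nat -> pred I).
Context (b_mono : forall r s i,
  (r <= s)%N -> (s < #|J|)%N -> i \in J -> b r i -> b s i).

Let stop_levelD1_lt j : j \in J -> (stop_level b (J :\ j)%SET < #|J|)%N.
Proof.
by move=> jJ; rewrite [leqRHS](cardsD1 j) jJ ltnS stop_level_le_card.
Qed.

(** By monotonicity [j] fails at every rank up to [s], so the counts on [J] and on [J :\ j] agree
    there, and both first drop to at most the rank at the same place. *)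
Lemma stop_levelD1 j : j \in J -> ~~ b (stop_level b (J :\ j)%SET) j ->
  stop_level b J = stop_level b (J :\ j)%SET.
Proof.
move=> jJ nbj; set s := stop_level b (J :\ j)%SET in nbj *.
have setE r : (r <= s)%N ->
    [set i in (J :\ j)%SET | b r i]%SET = [set i in J | b r i]%SET.
  move=> rs; apply/setP => i; rewrite !inE.
  have [->|//] := eqVneq i j; rewrite jJ /=; symmetry; apply/negbTE.
  by apply: contra nbj; apply: b_mono => //; exact: stop_levelD1_lt.
apply/eqP; rewrite eqn_leq; apply/andP; split.
  by apply: stop_level_min; rewrite -setE//; exact: card_stop_level.
rewrite leqNgt; apply/negP => ltJ; move: (ltJ); rewrite ltnNge => /negP; apply.
rewrite /s; apply: stop_level_min; rewrite setE ?(ltnW ltJ)//; exact: card_stop_level.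
Qed.

(** Every term present has level [s], hence equals [1 / (#|J| - s)]. By minimality of [s] at least
    [s] indices pass at level [s], so there are at most [#|J| - s] terms. *)
Lemma sum_stop_levelD1_le1 (R : realType) :
  \sum_(j in J | ~~ b (stop_level b (J :\ j)%SET) j)
     ((#|J| - stop_level b (J :\ j)%SET)%:R^-1 : R) <= 1.
Proof.
set s := stop_level b J.
(* A term of the sum is needed to know that [s < #|J|], which makes the denominator positive. *)
have [j0 /andP[j0J nbj0]|none] :=
  pickP (fun j => (j \in J) && ~~ b (stop_level b (J :\ j)%SET) j); last first.
  by rewrite big_pred0.
have ltsJ : (s < #|J|)%N.
  by rewrite /s (stop_levelD1 j0J nbj0) stop_levelD1_lt.
apply: (@le_trans _ _ (\sum_(j in [set j in J | ~~ b s j]%SET) (#|J| - s)%:R^-1)).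
  rewrite [leRHS](eq_bigl (fun j => (j \in J) && ~~ b s j)); last first.
    by move=> j; rewrite !inE.
  rewrite big_mkcond [leRHS]big_mkcond /=; apply: ler_sum => j _.
  case: ifP => [/andP[jJ nbj]|_]; last by case: ifP => // _; rewrite invr_ge0.
  by have sE := stop_levelD1 jJ nbj; rewrite jJ /s !sE nbj.
rewrite sumr_const -[_ *+ #|_|]mulr_natl ler_pdivrMr ?ltr0n ?subn_gt0// mul1r ler_nat.
suff : (s <= #|[set j in J | b s j]%SET|)%N.
  have := cardsID [set j | b s j]%SET J.
  rewrite -setIdE => <- sle.
  have -> : [set j in J | ~~ b s j]%SET = (J :\: [set j | b s j])%SET.
    by apply/setP => j; rewrite !inE andbC.
  by rewrite leq_subRL ?leq_addr ?(leq_trans sle) ?leq_addr// leq_add2r.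
case sE : s => [//|r]; rewrite -sE.
(* By minimality more than [s - 1] indices pass at level [s - 1], and they still pass at level
   [s]. *)
have : ~~ (#|[set i in J | b r i]%SET| <= r)%N.
  by apply/negP => /stop_level_min; rewrite -/s sE ltnn.
rewrite -ltnNge sE => /leq_trans; apply; apply: subset_leq_card.
apply/fintype.subsetP => i; rewrite !inE => /andP[iJ bri]; rewrite iJ /=.
by apply: b_mono bri => //; rewrite -sE.
Qed.

End stop_level.

(** * The stepdown procedure on sorted p-values *)

Section stepdown.
Context (R : realType) (H : finType) (F : {set H}).
Implicit Types (p : H -> R) (a : nat -> R).

Lemma stepdown_indexP p m a :
  (stepdown_index F p m a <= m)%N /\
  forall j, (0 < j <= stepdown_index F p m a)%N -> ordered_pvalue F p j <= a j.
Proof.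
(* [Q] holds at 0 and is closed under [maxn], so it passes to the index even when no rank
   qualifies. *)
pose Q x := (x <= m)%N && all (fun j => ordered_pvalue F p j <= a j) (iota 1 x).
suff /andP[-> /allP Qi] : Q (stepdown_index F p m a).
  by split => // j /andP[j0 ji]; apply: Qi; rewrite mem_iota j0 add1n ltnS.
rewrite /stepdown_index big_nat_cond; apply: (big_ind Q) => //.
  by move=> x y Qx Qy; rewrite /maxn; case: ifP.
by move=> i /andP[/andP[_ im] Qi]; rewrite /Q -ltnS im.
Qed.

Lemma size_ordered_hyps p : size (ordered_hyps F p) = #|F|.
Proof. by rewrite size_sort -cardE. Qed.

Lemma mem_ordered_hyps p h : (h \in ordered_hyps F p) = (h \in F).
Proof. by rewrite mem_sort mem_enum. Qed.

Lemma ordered_pvalueE p h0 k : (k < #|F|)%N ->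
  ordered_pvalue F p k.+1 = p (nth h0 (ordered_hyps F p) k).
Proof. by move=> kF; rewrite /ordered_pvalue (nth_map h0)// size_ordered_hyps. Qed.

(** Both the sorting and the index use only comparisons. This reduces the measurability of the
    rejections to finitely many comparison events. *)
Lemma stepdown_eq p q m a :
  (forall h h', (p h <= p h') = (q h <= q h')) ->
  (forall h k, (0 < k <= m)%N -> (p h <= a k) = (q h <= a k)) ->
  stepdown F p m a = stepdown F q m a.
Proof.
move=> pq pqa; have ordE : ordered_hyps F p = ordered_hyps F q.
  by rewrite /ordered_hyps; congr sort; apply/funext => h; apply/funext => h'.
suff idxE : stepdown_index F p m a = stepdown_index F q m a.
  by rewrite /stepdown ordE idxE.
rewrite /stepdown_index big_nat_cond [RHS]big_nat_cond; apply: eq_bigl => i.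
apply: andb_id2l => /andP[_ im]; apply: eq_in_all => j.
rewrite mem_iota add1n => /andP[j0 ji].
have jm : (j <= m)%N by rewrite -ltnS (leq_trans ji).
(* Ranks beyond the list have the default p-value 0 on both sides. *)
rewrite /ordered_pvalue ordE; have [jF|jF] := ltnP j.-1 (size (ordered_hyps F q)).
  have h0 : H by case: (ordered_hyps F q) jF.
  by rewrite !(nth_map h0)// pqa// j0.
by rewrite !nth_default ?size_map.
Qed.

(** Take for [h0] the first hypothesis satisfying [T] in sorted order and for [r] its position from
    0. For [k <= r] the first [k] hypotheses of the list fail [T], and their p-values are at most
    the [k]-th, hence at most [a k]. *)
Lemma stepdown_first p m a (T : pred H) h :
  h \in stepdown F p m a -> T h ->
  exists h0 r, [/\ h0 \in F, T h0, (r < m)%N, p h0 <= a r.+1 &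
    forall k, (0 < k <= r)%N ->
      (k <= #|[set h in F | ~~ T h & (p h <= a k)%R]%SET|)%N].
Proof.
set s := ordered_hyps F p; set n := stepdown_index F p m a.
rewrite inE -/s -/n => hs Th.
have [nm pn] := stepdown_indexP p m a; rewrite -/n in nm pn.
pose r := find T s.
have hasT : has T (take n s) by apply/hasP; exists h.
have hass : has T s by rewrite -(cat_take_drop n s) has_cat hasT.
have rs : (r < size s)%N by rewrite -has_find.
have rn : (r < n)%N.
  have := hasT; rewrite has_find size_take_min => /leq_trans/(_ (geq_minl _ _)).
  by rewrite /r -{2}(cat_take_drop n s) find_cat hasT.
have size_s : size s = #|F| by exact: size_ordered_hyps.
have s_sorted : sorted (fun h h' => p h <= p h') s.
  by apply: sort_sorted => x y; exact: le_total.
have s_nth i j : (i <= j)%N -> (j < size s)%N -> p (nth h s i) <= p (nth h s j).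
  move=> ij js; apply: (sorted_leq_nth _ _ _ s_sorted) => //.
  - by move=> x y z; exact: le_trans.
  - by rewrite inE (leq_ltn_trans ij).
exists (nth h s r), r; split.
- by rewrite -(mem_ordered_hyps p) mem_nth.
- exact: nth_find.
- exact: leq_trans nm.
- by rewrite -ordered_pvalueE -?size_s// pn.
move=> [//|k] /= kr.
have ks : (k.+1 <= size s)%N by rewrite ltnW// (leq_ltn_trans kr).
have uniq_s : uniq s by rewrite sort_uniq enum_uniq.
rewrite -{1}(size_takel ks) -(card_uniqP (take_uniq _ uniq_s)).
apply: subset_leq_card; apply/fintype.subsetP => x /(nthP h)[i].
rewrite size_takel// => ik; rewrite nth_take// => <-; rewrite !inE.
have is_ : (i < size s)%N by exact: leq_trans ik ks.
rewrite -(mem_ordered_hyps p) mem_nth//= before_find ?(leq_trans ik)//=.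
apply: le_trans (s_nth i k ik ks) _.
by rewrite -ordered_pvalueE -?size_s// pn// (leq_trans kr)// ltnW.
Qed.

End stepdown.

(** * Laws of single p-values *)

Lemma le_dense_left (R : realType) (a b c : R) : a < b ->
  (forall q, a <= q < b -> q <= c) -> b <= c.
Proof.
move=> ab qc; rewrite leNgt; apply/negP => cb.
have /midf_lt[mq qb] : Num.max a c < b by rewrite gt_max ab.
have /qc : a <= (Num.max a c + b) / 2%:R < b.
  by rewrite qb andbT ltW// (le_lt_trans _ mq)// le_max lexx.
by rewrite leNgt (le_lt_trans _ mq)// le_max lexx orbT.
Qed.

Section uniform_law.
Context (d : measure_display) (Omega : measurableType d) (R : realType).
Context (P : probability Omega R) (U : Omega -> R) (mU : measurable_fun setT U).

Let mle p : measurable [set w | U w <= p].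
Proof. exact: measurable_sublevel. Qed.

Let mlt p : measurable [set w | U w < p].
Proof. exact: measurable_strict_sublevel. Qed.

(** Complementation turns [<=] into [<], and there is no atom: the probability of [U < q] is at most
    [q] and at least every smaller nonnegative value. *)
Lemma uniform_onem :
  (forall p, 0 <= p <= 1 -> P [set w | U w <= p] = p%:E) ->
  forall p, 0 <= p <= 1 -> P [set w | 1 - U w <= p] = p%:E.
Proof.
move=> unifU p /andP[p0 p1].
have -> : [set w | 1 - U w <= p] = ~` [set w | U w < 1 - p].
  by apply/seteqP; split => w /=; rewrite lerBlDr -lerBlDl leNgt => /negP.
rewrite probability_setC//.
suff -> : P [set w | U w < 1 - p] = (1 - p)%:E by rewrite -EFinB opprB addrC subrK.
have q01 : 0 <= 1 - p <= 1 by rewrite subr_ge0 p1 gerBl.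
rewrite -(fineK (fin_num_measure P _ (mlt (1 - p)))); congr EFin.
apply/eqP; rewrite eq_le; apply/andP; split.
  rewrite -[leRHS]/(fine (1 - p)%:E) -unifU//; apply: le_fine_prob => //.
  by move=> w /=; exact: ltW.
have [->|p_neq1] := eqVneq p 1; first by rewrite subrr fine_ge0.
have p_lt1 : 0 < 1 - p by rewrite subr_gt0 lt_neqAle p_neq1.
apply: (le_dense_left p_lt1) => q /andP[q0 q1].
have q01' : 0 <= q <= 1 by rewrite q0 (le_trans (ltW q1))// gerBl.
rewrite -[leLHS]/(fine q%:E) -unifU//; apply: le_fine_prob => //.
by move=> w /= /le_lt_trans; apply.
Qed.

(** Let the upper threshold increase to [q]. The strict form is the one used later, because the
    complement of [1 - U <= a] is [U < 1 - a]. *)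
Lemma ratio_left_limit :
  (forall p q, 0 <= p -> p <= q -> q <= 1 ->
     fine (P [set w | U w <= p]) * q <= p * fine (P [set w | U w <= q])) ->
  forall p q, 0 <= p -> p < q -> q <= 1 ->
    fine (P [set w | U w <= p]) * q <= p * fine (P [set w | U w < q]).
Proof.
move=> ratio p q p0 pq q1.
set G := fine (P [set w | U w <= p]).
have G0 : 0 <= G by exact: fine_ge0.
(* The case [G = 0] is separate because the limit argument divides by [G]. *)
move: G0; rewrite le_eqVlt => /orP[/eqP <-|G0]; first by rewrite mul0r mulr_ge0// fine_ge0.
rewrite mulrC -ler_pdivlMr//; apply: (le_dense_left pq) => r /andP[pr rq].
rewrite ler_pdivlMr// mulrC (le_trans (ratio _ _ p0 pr _))//.
  by rewrite (le_trans (ltW rq)).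
by rewrite ler_wpM2l//; apply: le_fine_prob => // w /= /le_lt_trans; apply.
Qed.

End uniform_law.

(** Under [P0] the conditional probability is [p / q]. The cross-multiplied form remains true when
    [q] or the probability of the conditioning event is 0. *)
Lemma sub_uniform_ratio (d : measure_display) (Omega : measurableType d)
    (R : realType) (P P0 : probability Omega R) (U : Omega -> R) :
  measurable_fun setT U ->
  (forall p, 0 <= p <= 1 -> P0 [set w | U w <= p] = p%:E) ->
  (forall p q, 0 <= p -> p <= q -> q <= 1 ->
     (0 < P [set w | (U w <= q)%R])%E -> (0 < P0 [set w | (U w <= q)%R])%E ->
     cond_prob P [set w | U w <= p] [set w | U w <= q]
       <= cond_prob P0 [set w | U w <= p] [set w | U w <= q]) ->
  forall p q, 0 <= p -> p <= q -> q <= 1 ->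
    fine (P [set w | U w <= p]) * q <= p * fine (P [set w | U w <= q]).
Proof.
move=> mU unifU hcond p q p0 pq q1.
have mle r : measurable [set w | U w <= r] by exact: measurable_sublevel.
have subpq : [set w | U w <= p] `<=` [set w | U w <= q].
  by move=> w /= /le_trans; apply.
have q0 : 0 <= q by exact: le_trans pq.
have p01 : 0 <= p <= 1 by rewrite p0 (le_trans pq).
move: q0; rewrite le_eqVlt => /orP[/eqP q0|q0].
  by rewrite -q0 mulr0 mulr_ge0// fine_ge0.
have Pq0 : (0 <= P [set w | (U w <= q)%R])%E by [].
have Ppq : (P [set w | (U w <= p)%R] <= P [set w | (U w <= q)%R])%E.
  by apply: le_measure; rewrite ?inE.
move: Pq0; rewrite le_eqVlt => /orP[/eqP Pq0|Pq0].
  have -> : P [set w | U w <= p] = 0%E.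
    by apply/eqP; rewrite eq_le measure_ge0 andbT Pq0.
  by rewrite -Pq0 mul0r mulr0.
have q01 : 0 <= q <= 1 by rewrite (ltW q0) q1.
have := hcond p q p0 pq q1 Pq0; rewrite unifU// lte_fin => /(_ q0).
rewrite /cond_prob (setIidl subpq) !unifU//=.
have fPq0 : 0 < fine (P [set w | U w <= q]).
  by rewrite fine_gt0// Pq0 ltey_eq fin_num_measure.
by rewrite ler_pdivrMr// mulrAC ler_pdivlMr.
Qed.

(** * Error bound for one block *)

Section block.
Context (d : measure_display) (Omega : measurableType d) (R : realType).
Context (P : probability Omega R) (I : finType) (J : {set I}).
Context (X : I -> {RV P >-> R}) (x : I -> R -> R).
Context (mx : forall i, measurable_fun setT (x i)).
Context (a : nat -> R) (c : R).

Let small w (r : nat) : pred I := [pred i | 1 - x i (X i w) <= a r.+1].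
Let level w j := stop_level (small w) (J :\ j)%SET.

Let measurable_le p i : measurable [set t | x i t <= p].
Proof. exact: measurable_sublevel. Qed.

Let measurable_lt p i : measurable [set t | x i t < p].
Proof. exact: measurable_strict_sublevel. Qed.

(** The level of [j] sees the other pairs only through comparisons with [#|J|] thresholds, which
    form a finite code. *)
Let independent_level j r A : mutually_independent P J X -> j \in J ->
  measurable A ->
  measurable [set w | level w j = r] /\
  fine (P (X j @^-1` A `&` [set w | level w j = r])) =
  fine (P (X j @^-1` A)) * fine (P [set w | level w j = r]).
Proof.
move=> indX jJ mA.
pose g (i : I) (t : R) : {ffun 'I_#|J| -> bool} :=
  [ffun k : 'I_#|J| => 1 - x i t <= a k.+1].
apply: (independent_coded_event (g := g) indX jJ mA).
  move=> i; apply: measurable_ffun_code => k b.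
  have smallE t : (1 - x i t <= a k.+1) = ~~ (x i t < 1 - a k.+1).
    by rewrite lerBlDr -lerBlDl leNgt.
  case: b.
    have -> : [set t | g i t k = true] = ~` [set t | x i t < 1 - a k.+1].
      by apply/seteqP; split => t /=; rewrite ffunE smallE => /negP.
    exact: measurableC.
  have -> : [set t | g i t k = false] = [set t | x i t < 1 - a k.+1].
    by apply/seteqP; split => t /=; rewrite ffunE smallE; [move/negbFE|move=> ->].
  exact: measurable_lt.
move=> w w' gE <-; symmetry; apply: eq_stop_level => q i qJ iJ.
have qJ' : (q < #|J|)%N by rewrite (leq_trans qJ)// subset_leq_card// finset.subD1set.
by move/ffunP/(_ (Ordinal qJ')): (gE i iJ); rewrite !ffunE.
Qed.

Lemma prob_le_level_crit (E : set Omega) :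
  mutually_independent P J X -> measurable E -> 0 <= c ->
  (forall r s, (r <= s)%N -> (s < #|J|)%N -> a r.+1 <= a s.+1) ->
  (forall r, (r < #|J|)%N ->
     0 <= a r.+1 < 1 /\ a r.+1 * (#|J| - r)%:R = c * (1 - a r.+1)) ->
  (forall r j, (r < #|J|)%N -> j \in J ->
     fine (P [set w | x j (X j w) <= a r.+1]) * (1 - a r.+1)
     <= a r.+1 * fine (P [set w | x j (X j w) < 1 - a r.+1])) ->
  (forall w, E w -> exists2 j, j \in J & x j (X j w) <= a (level w j).+1) ->
  fine (P E) <= c.
Proof.
move=> indX mE c0 a_mono a_crit ratio hE.
(* For [k = (j, r)], both events fix the level of [j] to [r]. In [A] the true p-value of [j] passes
   the critical value of that level; in [B] the false one exceeds it. *)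
pose A (k : I * 'I_#|J|) : set Omega := if k.1 \in J then
  X k.1 @^-1` [set t | x k.1 t <= a k.2.+1] `&` [set w | level w k.1 = k.2]
  else set0.
pose B (k : I * 'I_#|J|) : set Omega := if k.1 \in J then
  X k.1 @^-1` [set t | x k.1 t < 1 - a k.2.+1] `&` [set w | level w k.1 = k.2]
  else set0.
have mA k : measurable (A k).
  rewrite /A; case: ifP => // kJ; apply: measurableI.
    exact: measurable_funPTI.
  by have [] := independent_level k.2 indX kJ measurableT.
have mB k : measurable (B k).
  rewrite /B; case: ifP => // kJ; apply: measurableI.
    exact: measurable_funPTI.
  by have [] := independent_level k.2 indX kJ measurableT.
have level_lt w j : j \in J -> (level w j < #|J|)%N.
  by move=> jJ; rewrite [ltnRHS](cardsD1 j) jJ ltnS stop_level_le_card.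
have le1 : fine (P E) <= \sum_k fine (P (A k)).
  have -> : fine (P E) = \sum_(u : unit) 1 * fine (P E).
    by rewrite sumr_const card_unit mul1r.
  rewrite [leRHS](eq_bigr (fun k => 1 * fine (P (A k)))); last first.
    by move=> k _; rewrite mul1r.
  apply: ler_sum_fine_prob => // w; rewrite sumr_const card_unit mul1r.
  have [Ew|nEw] := pselect (E w); last first.
    by rewrite indicE memNset// sumr_ge0// => k _; rewrite mul1r.
  have [j jJ xj] := hE w Ew.
  rewrite (bigD1 (j, Ordinal (level_lt w j jJ)))//= -[leLHS]addr0 lerD//.
    rewrite mul1r !indicE !mem_set//.
    by rewrite /A /= jJ.
  by rewrite sumr_ge0// => k _; rewrite mul1r.
(* Independence detaches the level. The ratio bound then trades [x j <= a] for [x j < 1 - a] at the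
   cost [a / (1 - a)], which is [c / (#|J| - r)]. *)
have le2 k : fine (P (A k)) <= c * ((#|J| - k.2)%:R^-1 * fine (P (B k))).
  case: k => j r; rewrite /A /B /=; case: ifP => jJ; last by rewrite measure0 !mulr0.
  have [_ ->] := independent_level r indX jJ (measurable_le (a r.+1) j).
  have [_ ->] := independent_level r indX jJ (measurable_lt (1 - a r.+1) j).
  rewrite !mulrA ler_wpM2r ?fine_ge0//.
  have [/andP[ar0 ar1] ac] := a_crit r (ltn_ord r).
  have := ratio r j (ltn_ord r) jJ.
  have m0 : 0 < (#|J| - r)%:R :> R by rewrite ltr0n subn_gt0.
  have a1 : 0 < 1 - a r.+1 by rewrite subr_gt0.
  rewrite -ler_pdivlMr// => /le_trans; apply.
  suff -> : c / (#|J| - r)%:R = a r.+1 / (1 - a r.+1) by rewrite mulrAC.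
  by apply/eqP; rewrite eqr_div ?lt0r_neq0// -ac mulrC.
apply: (le_trans le1); apply: (le_trans (ler_sum _ (fun k _ => le2 k))).
rewrite -mulr_sumr -[leRHS]mulr1 ler_wpM2l//.
rewrite [leRHS](_ : 1 = \sum_(u : unit) 1 * fine (P setT)); last first.
  by rewrite sumr_const card_unit mul1r probability_setT.
apply: ler_sum_fine_prob => // w.
rewrite sumr_const card_unit mul1r indicT.
rewrite -(pair_bigA _ (fun (j : I) (r : 'I_#|J|) => (#|J| - r)%:R^-1 * \1_(B (j, r)) w)) /=.
(* At a fixed outcome only the level actually attained contributes to the sum over [r]. *)
apply: le_trans (sum_stop_levelD1_le1 (J := J) (b := small w) _ R).
  rewrite [leRHS]big_mkcond /=; apply: ler_sum => j _.
  have [jJ|jJ] := boolP (j \in J); last first.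
    by rewrite big1// => r _; rewrite /B /= (negbTE jJ) indic0 mulr0.
  rewrite (bigD1 (Ordinal (level_lt w j jJ)))//= big1 ?addr0; last first.
    move=> r nr; rewrite indicE memNset ?mulr0//.
    rewrite /B /= jJ => -[_ /= lr]; move/eqP: nr; apply; exact/val_inj.
  rewrite -/(level w j) indicE; case: ifPn => nb.
    by rewrite ler_piMr ?invr_ge0// lern1 leq_b1.
  rewrite memNset ?mulr0//.
  rewrite /B /= jJ => -[/= xj _]; move/negP: nb; apply.
  by rewrite /= -ltNge ltrBrDr -ltrBrDl.
move=> r s i rs sJ iJ; rewrite /small /= => /le_trans; apply; exact: a_mono.
Qed.

End block.

(** * Critical values of a block *)

Section block_crit.
Context (R : realType) (n : nat) (alpha : R) (J : {set 'I_n}).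
Let c : R := #|J|%:R * alpha / n%:R.

Lemma block_critE r : (r < #|J|)%N ->
  block_crit alpha J r.+1 = c / ((#|J| - r)%:R + c).
Proof.
move=> rJ; rewrite /block_crit -/c natrB 1?ltnW// -[r.+1]addn1 natrD.
by congr (_ / (_ + _)); lra.
Qed.

Context (halpha : 0 < alpha < 1).

Lemma block_level_ge0 : 0 <= c.
Proof. by have /andP[a0 _] := halpha; rewrite /c divr_ge0// mulr_ge0// ltW. Qed.

Lemma block_level_lt1 : c < 1.
Proof.
rewrite /c; have [n0|n0] := posnP n.
  (* The inverse of 0 is 0, so [c = 0] here. *)
  by rewrite [n%:R](_ : _ = 0) ?invr0 ?mulr0// n0.
rewrite ltr_pdivrMr ?ltr0n// mul1r.
have Jn : #|J|%:R <= n%:R :> R by rewrite ler_nat -[n in leqRHS]card_ord max_card.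
have n0' : 0 < n%:R :> R by rewrite ltr0n.
by have /andP[a0 a1] := halpha; nra.
Qed.

(** The bound by one half comes from [c < 1 <= #|J| - r]; it keeps the two p-values of a pair from
    both being at most critical values. *)
Lemma block_crit_bound r : (r < #|J|)%N ->
  0 <= block_crit alpha J r.+1 < 2^-1 /\
  block_crit alpha J r.+1 * (#|J| - r)%:R
    = c * (1 - block_crit alpha J r.+1).
Proof.
move=> rJ; rewrite block_critE//.
have D1 : 1 <= (#|J| - r)%:R :> R by rewrite ler1n subn_gt0.
have c0 := block_level_ge0; have c1 := block_level_lt1.
set D := (#|J| - r)%:R in D1 *.
have Dc : 0 < D + c by lra.
split; first by rewrite divr_ge0 ?(ltW Dc)//= ltr_pdivrMr//; lra.
have -> : 1 - c / (D + c) = D / (D + c).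
  by rewrite -[1](divff (lt0r_neq0 Dc)) -mulrBl addrK.
by rewrite mulrAC mulrA.
Qed.

Lemma block_crit_le r s : (r <= s)%N -> (s < #|J|)%N ->
  block_crit alpha J r.+1 <= block_crit alpha J s.+1.
Proof.
move=> rs sJ; rewrite !block_critE ?(leq_ltn_trans rs)//.
have D1 : 1 <= (#|J| - s)%:R :> R by rewrite ler1n subn_gt0.
have D2 : (#|J| - s)%:R <= (#|J| - r)%:R :> R by rewrite ler_nat leq_sub2l.
have c0 := block_level_ge0.
by rewrite ler_wpM2l// lef_pV2 ?posrE; lra.
Qed.

End block_crit.

(** * Errors of the directional procedure in a block *)

Section pvalues.
Context (d : measure_display) (Omega : measurableType d) (R : realType).
Context (n : nat) (T : 'I_n -> {mfun Omega >-> R}) (F0 : 'I_n -> R -> R).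
Context (theta : 'I_n -> R).

Lemma hyp_holdsE (h : hyp n) : hyp_holds theta h = (h.2 == (0 < theta h.1)).
Proof.
by rewrite /hyp_holds; case: h.2; rewrite ?eqb_id// leNgt; case: ltP.
Qed.

Lemma true_hypE (h : hyp n) : hyp_holds theta h -> h = true_hyp theta h.1.
Proof. by rewrite hyp_holdsE /true_hyp => /eqP <-; case: h. Qed.

Lemma false_pvalueE w (h : hyp n) : ~~ hyp_holds theta h ->
  pvalue T F0 w h = 1 - true_pvalue T F0 theta h.1 w.
Proof.
rewrite hyp_holdsE /true_pvalue /pvalue /=.
by case: h.2; case: (0 < theta h.1) => //=; rewrite opprB addrC subrK.
Qed.

Lemma measurable_pvalue (h : hyp n) : (forall j, continuous (F0 j)) ->
  measurable_fun setT (fun w => pvalue T F0 w h).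
Proof.
move=> cF0; have mFT : measurable_fun setT (fun w => F0 h.1 (T h.1 w)).
  apply: (@measurableT_comp _ _ _ _ _ _ (F0 h.1)); last exact: measurable_funPT.
  exact: continuous_measurable_fun.
by rewrite /pvalue; case: h.2 => //; exact: measurable_funB.
Qed.

Context (alpha : R) (J : {set 'I_n}).

Definition block_error : set Omega :=
  [set w | exists2 h, h \in block_rejections T F0 alpha J w & hyp_holds theta h].

Lemma measurable_block_error :
  (forall j, continuous (F0 j)) -> measurable block_error.
Proof.
move=> cF0.
(* By [stepdown_eq] the rejected set is determined by the comparisons of the p-values with one
   another and with the critical values. *)
pose code w : {ffun hyp n * (hyp n + 'I_#|J|) -> bool} :=
  [ffun k : hyp n * (hyp n + 'I_#|J|) => match k.2 with
    | inl h => pvalue T F0 w k.1 <= pvalue T F0 w h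
    | inr r => pvalue T F0 w k.1 <= block_crit alpha J r.+1
    end].
apply: (@measurable_fin_code _ _ _ code).
  apply: measurable_ffun_code => -[h k] b.
  have mpv := measurable_pvalue _ cF0.
  case: k => [h'|r].
    rewrite (_ : [set w | _]
      = (fun w => pvalue T F0 w h <= pvalue T F0 w h') @^-1` [set b]); last first.
      by apply/seteqP; split => w /=; rewrite ffunE.
    by rewrite -[X in measurable X]setTI; exact: measurable_fun_ler.
  rewrite (_ : [set w | _]
    = (fun w => pvalue T F0 w h <= block_crit alpha J r.+1) @^-1` [set b]); last first.
    by apply/seteqP; split => w /=; rewrite ffunE.
  by rewrite -[X in measurable X]setTI; exact: measurable_fun_ler.
move=> w w' ww' [h hw hh]; exists h => //; move: hw.
rewrite /block_rejections (@stepdown_eq _ _ _ _ (pvalue T F0 w'))//.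
  by move=> h1 h2; move/ffunP/(_ (h1, inl h2)): ww'; rewrite !ffunE.
move=> h1 [//|k] /= kJ.
by move/ffunP/(_ (h1, inr (Ordinal kJ))): ww'; rewrite !ffunE.
Qed.

(** Let [r] be the position of the first true rejected hypothesis, of pair [j]. If the level [s]
    without pair [j] were less than [r], at least [s.+1] false p-values from other pairs would be at
    most the critical value of rank [s.+1], against the choice of [s]. So [r <= s], and the critical
    values are nondecreasing. *)
Lemma block_error_level w : 0 < alpha < 1 -> block_error w ->
  exists2 j, j \in J &
    true_pvalue T F0 theta j w <= block_crit alpha J (stop_level
      (fun r => [pred i | 1 - true_pvalue T F0 theta i w
                          <= block_crit alpha J r.+1]) (J :\ j)%SET).+1.
Proof.
move=> halpha [h hw hh].
have [h0 [r [h0J h0T rJ h0r card_ge]]] := stepdown_first hw hh.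
have h0E := true_hypE h0T; set j := h0.1 in h0E.
have jJ : j \in J by move: h0J; rewrite inE.
exists j => //; set b := fun r : nat => _.
have pj : pvalue T F0 w h0 = true_pvalue T F0 theta j w by rewrite h0E.
rewrite pj in h0r; apply: (le_trans h0r).
have ltJ : (stop_level b (J :\ j)%SET < #|J|)%N.
  by rewrite [ltnRHS](cardsD1 j) jJ ltnS stop_level_le_card.
apply: block_crit_le => //; rewrite leqNgt; apply/negP => ltr.
set s := stop_level b (J :\ j)%SET in ltJ ltr.
have := card_stop_level b (J :\ j)%SET; rewrite -/s leqNgt => /negP; apply.
apply: (leq_trans (card_ge s.+1 ltr)).
(* Each pair has a single false hypothesis, so counting these amounts to counting pairs. *)
rewrite -(card_in_imset (f := fst)); last first.
  move=> [i1 b1] [i2 b2]; rewrite !inE !hyp_holdsE /=.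
  move=> /and3P[_ n1 _] /and3P[_ n2 _] /= i12; rewrite -i12 in n2 *.
  by congr pair; move: n1 n2; case: b1; case: b2; case: (0 < theta i1).
apply: subset_leq_card; apply/fintype.subsetP => i /imsetP[h1].
rewrite !inE => /and3P[h1J h1T h1s] ->; rewrite false_pvalueE// in h1s.
rewrite h1J andbT; apply/andP; split=> [|//]; apply/negP => /eqP h1j; rewrite h1j in h1s.
(* Pair [j] itself is excluded: its two p-values sum to 1, yet both would be below one half. *)
have [/andP[_ bs] _] := block_crit_bound halpha ltJ.
have [/andP[_ br] _] := block_crit_bound halpha rJ.
by move: (true_pvalue _ _ _ _ _) h0r h1s => z; lra.
Qed.

End pvalues.

(** * Summation over the blocks *)

Theorem theorem3 (R : realType) (d : measure_display) (Omega : measurableType d)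
  (n : nat) (hn : (1 <= n)%N)
  (alpha : R) (halpha : 0 < alpha < 1)
  (* the statistical model *)
  (Pr : ('I_n -> R) -> probability Omega R)
  (T : 'I_n -> {mfun Omega >-> R})
  (F : 'I_n -> R -> R -> R)
  (hcdf : forall (theta : 'I_n -> R) (j : 'I_n) (t : R),
     cdf (T j : {RV (Pr theta) >-> R}) t = (F j (theta j) t)%:E)
  (hcont : forall j : 'I_n, continuous (F j 0))
  (hsymm : forall (j : 'I_n) (t : R), F j 0 (- t) = 1 - F j 0 t)
  (hmono : forall (j : 'I_n) (t x y : R), x <= y -> F j y t <= F j x t)
  (* the blocks *)
  (blocks : {set {set 'I_n}})
  (hblocks : finset.partition blocks [set: 'I_n]%SET)
  (* A.1 *)
  (hA1 : forall (theta : 'I_n -> R) (j : 'I_n) (p : R), 0 <= p <= 1 ->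
     let P_j := true_pvalue T (fun i => F i 0) theta j in
     (Pr theta [set w | (P_j w <= p)%R] <= p%:E)%E /\
     (theta j = 0 -> Pr theta [set w | P_j w <= p] = p%:E))
  (* A.2 *)
  (hA2 : forall (theta theta0 : 'I_n -> R) (j : 'I_n) (p p' : R),
     theta0 j = 0 -> 0 <= p -> p <= p' -> p' <= 1 ->
     let P_j := true_pvalue T (fun i => F i 0) theta j in
     (0 < Pr theta [set w | (P_j w <= p')%R])%E ->
     (0 < Pr theta0 [set w | (P_j w <= p')%R])%E ->
     cond_prob (Pr theta) [set w | P_j w <= p] [set w | P_j w <= p']
       <= cond_prob (Pr theta0) [set w | P_j w <= p] [set w | P_j w <= p'])
  (* A.3' *)
  (hA3 : forall (theta : 'I_n -> R) (J : {set 'I_n}), J \in blocks ->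
     mutually_independent (Pr theta) J T) :
  forall theta : 'I_n -> R,
    (FWER Pr
       (blockwise_procedure T (fun i => F i 0%R) alpha blocks) theta
     <= alpha%:E)%E.
Proof.
move=> theta; pose F0 (j : 'I_n) := F j 0; pose theta0 := fun _ : 'I_n => 0 : R.
have mpv j : measurable_fun setT (true_pvalue T F0 theta j) by exact: measurable_pvalue.
(* At [theta0] A.1 concerns [1 - F0 j (T j w)], as [0 < 0] fails. For positive [theta j] the true
   p-value is the reflection of this variable. *)
have unif0 j p : 0 <= p <= 1 ->
    Pr theta0 [set w | true_pvalue T F0 theta j w <= p] = p%:E.
  have unifU q : 0 <= q <= 1 -> Pr theta0 [set w | 1 - F0 j (T j w) <= q] = q%:E.
    move=> q01; have [_ /(_ erefl)] := hA1 theta0 j q q01.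
    by rewrite /true_pvalue /pvalue /= ltxx.
  rewrite /true_pvalue /pvalue /=; case: (0 < theta j); last exact: unifU.
  have mU : measurable_fun setT (fun w => 1 - F0 j (T j w)).
    exact: (measurable_pvalue T (j, false)).
  move=> p01; rewrite -(uniform_onem mU unifU p01).
  by congr (Pr theta0 _); apply/funext => w /=; rewrite opprB addrC subrK.
have ratio j := ratio_left_limit (mpv j) (sub_uniform_ratio (mpv j) (unif0 j)
  (fun p q => hA2 theta theta0 j p q erefl)).
have mE J : measurable (block_error T F0 theta alpha J).
  exact: measurable_block_error.
have block_le J : J \in blocks ->
    fine (Pr theta (block_error T F0 theta alpha J)) <= #|J|%:R * alpha / n%:R.
  move=> JB.
  (* The true p-value as a function of the statistic alone, so that the independence of the [T i]
     applies. *)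
  pose x i t : R := if 0 < theta i then F0 i t else 1 - F0 i t.
  have mx i : measurable_fun setT (x i).
    have mF : measurable_fun setT (F0 i) by apply: continuous_measurable_fun; exact: hcont.
    by rewrite /x; case: (0 < theta i) => /=; [exact: mF|exact: measurable_funB].
  apply: (prob_le_level_crit mx (a := block_crit alpha J) (hA3 theta J JB)) => //.
  - exact: block_level_ge0.
  - by move=> r s rs sJ; exact: block_crit_le.
  - move=> r rJ; have [/andP[a0 a1] ac] := block_crit_bound halpha rJ.
    by split=> //; rewrite a0; lra.
  (* A critical value [a] below one half satisfies [a < 1 - a], as the ratio bound requires. *)
  - move=> r j rJ jJ; have [/andP[a0 a1] _] := block_crit_bound halpha rJ.
    by apply: (ratio j) => //; lra.
  - by move=> w; exact: block_error_level.
have FWER_E : [set w | (1 <= num_false_rejections theta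
      (blockwise_procedure T F0 alpha blocks) w)%N]
    = \bigcup_(J in [set` blocks]) block_error T F0 theta alpha J.
  apply/seteqP; split => [w /= /card_gt0P[h]|w [J /= JB [h hw hh]]].
    rewrite inE => /andP[/bigcupP[J JB hw] hh].
    by exists J => //; exists h.
  by apply/card_gt0P; exists h; rewrite inE hh andbT; apply/bigcupP; exists J.
rewrite /FWER FWER_E.
have mU : measurable (\bigcup_(J in [set` blocks]) block_error T F0 theta alpha J).
  by apply: fin_bigcup_measurable => //; exact: finite_finset.
rewrite -[leLHS]fineK ?fin_num_measure// lee_fin.
pose A J := if J \in blocks then block_error T F0 theta alpha J else set0.
have mA J : measurable (A J) by rewrite /A; case: ifP.
have : fine (Pr theta (\bigcup_(J in [set` blocks]) block_error T F0 theta alpha J))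
    <= \sum_J 1 * fine (Pr theta (A J)).
  have E1 E : fine (Pr theta E) = \sum_(u : unit) 1 * fine (Pr theta E).
    by rewrite sumr_const card_unit mul1r.
  rewrite E1; apply: ler_sum_fine_prob => // w; rewrite sumr_const card_unit mul1r.
  have [[J JB Jw]|nw] := pselect
      ((\bigcup_(J in [set` blocks]) block_error T F0 theta alpha J) w).
    rewrite (bigD1 J)//= -[leLHS]addr0 lerD//.
      by rewrite mul1r /A JB !indicE !mem_set//; exists J.
    by rewrite sumr_ge0// => k _; rewrite mul1r.
  by rewrite indicE memNset// sumr_ge0// => k _; rewrite mul1r.
move=> /le_trans; apply.
(* The block sizes add up to [n], so the block levels add up to [alpha]. *)
have -> : alpha = \sum_(J in blocks) #|J|%:R * alpha / n%:R.
  rewrite -!mulr_suml -natr_sum -(card_partition hblocks) cardsT card_ord.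
  by rewrite mulrAC mulfV ?mul1r// pnatr_eq0 -lt0n.
rewrite [leRHS]big_mkcond /=; apply: ler_sum => J _.
rewrite mul1r /A; case: ifPn => [JB|_]; last by rewrite measure0.
exact: block_le.
Qed.
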